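(* Let $m\geq1$ and $k$ be integers with $\gcd(m,k)=1$ and $m-2k\equiv0$ mod $6$, and let $J_6(m,k)=\langle t,y\mid t^6,\ y^{m-k}t^3y^kt^2\rangle$. Then $$J_6(m,k)'\cong\begin{cases}\mathbb{Z}_{4^{m/2}-3^{m/2}}\oplus\mathbb{Z}_{4^{m/2}-3^{m/2}}&\text{if }m-2k\equiv0\text{ mod }12,\\ \mathbb{Z}_{4^{m/2}+3^{m/2}}\oplus\mathbb{Z}_{4^{m/2}+3^{m/2}}&\text{if }m-2k\equiv6\text{ mod }12.\end{cases}$$
   Context: $G'$ denotes the derived subgroup of $G$, and $\mathbb{Z}_q$ the cyclic group of order $q$ (trivial for $q=1$). The hypothesis forces $m$ to be even. *)

(* Defs.v *)
From HB Require Import structures.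
From mathcomp Require Import all_boot all_order all_algebra.
From mathcomp Require Import boolp.

Set Implicit Arguments.
Unset Strict Implicit.
Unset Printing Implicit Defensive.

Local Open Scope group_scope.
Local Open Scope quotient_scope.

Definition expgz (G : groupType) (x : G) (n : int) : G :=
  match n with Posz i => x ^+ i | Negz i => x ^- i.+1 end.

Definition isomorphic (G H : groupType) : Prop :=
  exists2 f : G -> H, {morph f : x y / x * y} & bijective f.

Inductive generated (G : groupType) (S : G -> Prop) : G -> Prop :=
| generated_in x of S x : generated S x
| generated1 : generated S 1
| generated_div x y of generated S x & generated S y : generated S (x / y).

Section Generated.
Variables (G : groupType) (S : G -> Prop).

Lemma generatedV x : generated S x -> generated S x^-1.
Proof. by rewrite -[x^-1]mul1g; apply: generated_div; apply: generated1. Qed.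

Lemma generatedM x y : generated S x -> generated S y -> generated S (x * y).
Proof.
by move=> Sx Sy; rewrite -[y]invgK; apply: generated_div => //; exact: generatedV.
Qed.

End Generated.

Section Derived.
Variable G : groupType.

Definition derived : {pred G} :=
  fun x => `[< generated (fun c => exists a b : G, c = [~ a, b]) x >].

Lemma derived_group_closed : group_closed derived.
Proof.
split=> [|x y /asboolP Dx /asboolP Dy]; apply/asboolP; first exact: generated1.
exact: generated_div.
Qed.

Definition derived_subgroup : Type := {x : G | x \in derived}.
HB.instance Definition _ := SubChoice.on derived_subgroup.
HB.instance Definition _ :=
  SubChoice_isSubGroup.Build G derived derived_subgroup derived_group_closed.

End Derived.

(* A word is a sequence of letters (x, b), standing for x if b = false and for
   x^-1 if b = true. *)
Section FreeGroup.
Variable X : choiceType.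
Let word := seq (X * bool).

Inductive free_equiv : word -> word -> Prop :=
| free_cancel u v x b :
    free_equiv (u ++ [:: (x, b), (x, ~~ b) & v]) (u ++ v)
| free_refl u : free_equiv u u
| free_sym u v of free_equiv u v : free_equiv v u
| free_trans u v w of free_equiv u v & free_equiv v w : free_equiv u w.

Definition free_rel : rel word := fun u v => `[< free_equiv u v >].

Lemma free_rel_refl : reflexive free_rel.
Proof. by move=> u; apply/asboolP; apply: free_refl. Qed.

Lemma free_rel_sym : symmetric free_rel.
Proof. by move=> u v; apply/asboolP/asboolP; apply: free_sym. Qed.

Lemma free_rel_trans : transitive free_rel.
Proof.
by move=> v u w /asboolP uv /asboolP vw; apply/asboolP; apply: free_trans vw.
Qed.

Canonical free_rel_equiv :=
  EquivRel free_rel free_rel_refl free_rel_sym free_rel_trans.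

Definition free_group : Type := {eq_quot free_rel}.
HB.instance Definition _ := Choice.on free_group.
HB.instance Definition _ := EqQuotient.on free_group.

Definition word_inv (u : word) : word := rev [seq (l.1, ~~ l.2) | l <- u].

Definition free_one : free_group := \pi_free_group [::].
Definition free_mul (x y : free_group) : free_group := \pi_free_group (repr x ++ repr y).
Definition free_inv (x : free_group) : free_group := \pi_free_group (word_inv (repr x)).

Lemma free_piP (u v : word) :
  free_equiv u v <-> \pi_free_group u = \pi_free_group v.
Proof.
split=> [uv|/eqP]; first by apply/eqP; rewrite eqmodE; apply/asboolP.
by rewrite eqmodE => /asboolP.
Qed.

Lemma free_reprP (u : word) : free_equiv (repr (\pi_free_group u)) u.
Proof. by apply/free_piP; rewrite reprK. Qed.

Lemma free_equiv_catl w u v : free_equiv u v -> free_equiv (w ++ u) (w ++ v).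
Proof.
elim=> {u v} [u v x b|u|u v _ uv|u v t _ uv _ vt].
- by rewrite !catA; apply: free_cancel.
- exact: free_refl.
- exact: free_sym.
- exact: free_trans vt.
Qed.

Lemma free_equiv_catr w u v : free_equiv u v -> free_equiv (u ++ w) (v ++ w).
Proof.
elim=> {u v} [u v x b|u|u v _ uv|u v t _ uv _ vt].
- by rewrite -!catA; apply: free_cancel.
- exact: free_refl.
- exact: free_sym.
- exact: free_trans vt.
Qed.

Lemma free_equiv_cat u u' v v' :
  free_equiv u u' -> free_equiv v v' -> free_equiv (u ++ v) (u' ++ v').
Proof.
move=> uu' vv'; apply: free_trans (free_equiv_catl _ vv').
exact: free_equiv_catr.
Qed.

Lemma free_equiv_inv u v :
  free_equiv u v -> free_equiv (word_inv u) (word_inv v).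
Proof.
elim=> {u v} [u v x b|u|u v _ uv|u v t _ uv _ vt].
- rewrite /word_inv !map_cat !rev_cat /= !rev_cons negbK -!cats1 -!catA /=.
  exact: free_cancel.
- exact: free_refl.
- exact: free_sym.
- exact: free_trans vt.
Qed.

Lemma word_invK : involutive word_inv.
Proof.
move=> u; rewrite /word_inv map_rev revK -map_comp -[RHS]map_id.
by apply: eq_map => -[x b] /=; rewrite negbK.
Qed.

Lemma word_mulV u : free_equiv (u ++ word_inv u) [::].
Proof.
elim/last_ind: u => [|u [x b] IH]; first exact: free_refl.
rewrite /word_inv map_rcons rev_rcons /= cat_rcons.
exact: free_trans (free_cancel _ _ _ _) IH.
Qed.

Lemma free_mulE (u v : word) :
  free_mul (\pi u) (\pi v) = \pi_free_group (u ++ v).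
Proof. by apply/free_piP; apply: free_equiv_cat; apply: free_reprP. Qed.

Lemma free_invE (u : word) : free_inv (\pi u) = \pi_free_group (word_inv u).
Proof. by apply/free_piP; apply: free_equiv_inv; apply: free_reprP. Qed.

Lemma free_mulA : associative free_mul.
Proof.
by move=> x y z; rewrite -[x]reprK -[y]reprK -[z]reprK !free_mulE catA.
Qed.

Lemma free_mul1 : left_id free_one free_mul.
Proof. by move=> x; rewrite -[x]reprK free_mulE. Qed.

Lemma free_mulr1 : right_id free_one free_mul.
Proof. by move=> x; rewrite -[x]reprK free_mulE cats0. Qed.

Lemma free_mulrV : right_inverse free_one free_inv free_mul.
Proof.
move=> x; rewrite -[x]reprK free_invE free_mulE.
by apply/free_piP; apply: word_mulV.
Qed.

Lemma free_mulV : left_inverse free_one free_inv free_mul.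
Proof.
move=> x; rewrite -[x]reprK free_invE free_mulE.
by apply/free_piP; rewrite -{2}[repr x]word_invK; apply: word_mulV.
Qed.

HB.instance Definition _ := isGroup.Build free_group
  free_mulA free_mul1 free_mulr1 free_mulV free_mulrV.

Definition free_gen (x : X) : free_group := \pi_free_group [:: (x, false)].

End FreeGroup.

Section QuotientByNormalClosure.
Variables (G : groupType) (R : G -> Prop).

Definition normal_closure : G -> Prop :=
  generated (fun c => exists r g : G, R r /\ c = r ^ g).

Lemma normal_closureJ x g : normal_closure x -> normal_closure (x ^ g).
Proof.
elim=> {x} [x [r [h [Rr ->]]]||x y _ Nx _ Ny].
- by apply: generated_in; exists r, (h * g); rewrite conjgM.
- by rewrite conj1g; apply: generated1.
- by rewrite conjMg conjVg; apply: generated_div.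
Qed.

Definition modulo_rel : rel G := fun x y => `[< normal_closure (x / y) >].

Lemma modulo_refl : reflexive modulo_rel.
Proof. by move=> x; apply/asboolP; rewrite mulgV; apply: generated1. Qed.

Lemma modulo_sym : symmetric modulo_rel.
Proof.
by move=> x y; apply/asboolP/asboolP => /generatedV; rewrite invgF.
Qed.

Lemma modulo_trans : transitive modulo_rel.
Proof.
move=> y x z /asboolP xy /asboolP yz; apply/asboolP.
by have := generatedM xy yz; rewrite mulgA mulgVK.
Qed.

Canonical modulo_equiv :=
  EquivRel modulo_rel modulo_refl modulo_sym modulo_trans.

Definition quotient_group : Type := {eq_quot modulo_rel}.
HB.instance Definition _ := Choice.on quotient_group.
HB.instance Definition _ := EqQuotient.on quotient_group.

Definition quo_one : quotient_group := \pi_quotient_group 1.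
Definition quo_mul (x y : quotient_group) : quotient_group :=
  \pi_quotient_group (repr x * repr y).
Definition quo_inv (x : quotient_group) : quotient_group :=
  \pi_quotient_group (repr x)^-1.

Lemma quo_piP (x y : G) :
  normal_closure (x / y) <-> \pi_quotient_group x = \pi_quotient_group y.
Proof.
split=> [xy|/eqP]; first by apply/eqP; rewrite eqmodE; apply/asboolP.
by rewrite eqmodE => /asboolP.
Qed.

Lemma quo_reprP (x : G) : normal_closure (repr (\pi_quotient_group x) / x).
Proof. by apply/quo_piP; rewrite reprK. Qed.

Lemma quo_mulE (x y : G) :
  quo_mul (\pi x) (\pi y) = \pi_quotient_group (x * y).
Proof.
apply/quo_piP; have Nx := quo_reprP x; have Ny := quo_reprP y.
move: (repr (\pi x)) (repr (\pi y)) Nx Ny => x' y' Nx /(normal_closureJ x'^-1) Ny.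
have -> : x' * y' / (x * y) = (y' / y) ^ x'^-1 * (x' / x).
  by rewrite conjgE invgK invgM !mulgA mulgVK.
exact: generatedM.
Qed.

Lemma quo_invE (x : G) : quo_inv (\pi x) = \pi_quotient_group x^-1.
Proof.
apply/quo_piP; move: (repr _) (quo_reprP x) => x' /generatedV.
by move/(normal_closureJ x'); rewrite invgF conjgE !mulgA mulgVK invgK.
Qed.

Lemma quo_mulA : associative quo_mul.
Proof.
by move=> x y z; rewrite -[x]reprK -[y]reprK -[z]reprK !quo_mulE mulgA.
Qed.

Lemma quo_mul1 : left_id quo_one quo_mul.
Proof. by move=> x; rewrite -[x]reprK quo_mulE mul1g. Qed.

Lemma quo_mulr1 : right_id quo_one quo_mul.
Proof. by move=> x; rewrite -[x]reprK quo_mulE mulg1. Qed.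

Lemma quo_mulV : left_inverse quo_one quo_inv quo_mul.
Proof. by move=> x; rewrite -[x]reprK quo_invE quo_mulE mulVg. Qed.

Lemma quo_mulrV : right_inverse quo_one quo_inv quo_mul.
Proof. by move=> x; rewrite -[x]reprK quo_invE quo_mulE mulgV. Qed.

HB.instance Definition _ := isGroup.Build quotient_group
  quo_mulA quo_mul1 quo_mulr1 quo_mulV quo_mulrV.

End QuotientByNormalClosure.

Definition presented_group (X : choiceType) (R : free_group X -> Prop)
  : groupType := quotient_group R.

(* The two generators t and y are indexed by false and true. *)
Definition J6_relator (m k : int) : free_group bool -> Prop :=
  let t := free_gen false in
  let y := free_gen true in
  fun r => r = t ^+ 6 \/ r = expgz y (m - k)%R * t ^+ 3 * expgz y k * t ^+ 2.

Definition J6 (m k : int) : groupType := presented_group (J6_relator m k).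

(* For q > 0 the carrier has exactly q elements, and the canonical group law of
   'I_n.+1 is addition modulo n.+1. The type 'Z_q is unsuitable here since 'Z_1
   has two elements. *)
Definition cyclic_group (q : nat) : groupType := 'I_q.-1.+1.

(* Main.v *)
(** Put z = y^m and c = y^k, so that z and c commute. The relator gives
    (z t^2)^2 = (z t^3)^3 = t^6 = 1, hence <t, z> is a quotient of the Euclidean
    triangle group (2,3,6), the semidirect product of Z[w] by Z_6, with w a
    primitive sixth root of 1. So z^6 = 1, k only matters modulo 6m, and the
    conjugates of t z^-1 in <t, z> generate an abelian group N, a cyclic
    Z[w]-module on which w acts as v |-> z v z^-1. The relator also says that
    v |-> c v c^-1 carries (1 + w)v to 2wv for v in N. Iterating it m = 2h times
    and using c^m = z^k and (1 + w)^2 = 3w, one gets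
    4^h v = w^(k - h) 3^h v, where w^(k - h) = 1 or -1 according to m - 2k
    modulo 12, so that qN = 0. As q is prime to 3, 1 + w is invertible on N,
    hence c, and so y, normalizes N; G/N is then cyclic and G' = N.
    Conversely, the affine maps x |-> xw + 1 and x |-> xb of Z[w]/q, where
    b^m = w and 2 b^k = 1 + w, satisfy the relations of t and y, so that N is
    not smaller than Z[w]/q. *)

From HB Require Import structures.
Require Import Defs.
From mathcomp Require Import all_boot all_order all_algebra.
From mathcomp Require Import perm zify ring boolp.

Set Implicit Arguments.
Unset Strict Implicit.
Unset Printing Implicit Defensive.

Import GRing.Theory.

Local Open Scope group_scope.
Local Open Scope quotient_scope.

(** * The Euclidean triangle group (2,3,6) and its translations *)

Section EuclideanTriangle.
Variables (G : groupType) (t p : G).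
Hypotheses (t6 : t ^+ 6 = 1) (p2 : p ^+ 2 = 1) (pt3 : (p * t) ^+ 3 = 1).

Let z := p / t / t.
Let e := t / z.

Let pp : p * p = 1. Proof. exact: p2. Qed.

Let pK x : x * p * p = x. Proof. by rewrite -mulgA pp mulg1. Qed.

Let pV : p^-1 = p. Proof. exact: mulg1_eq. Qed.

(** The relation [(p * t) ^+ 3 = 1] as a rewriting rule that trades two letters [p] for one; all the
    word computations below rest on it. *)
Let ptp : p * t * p = t^-1 * p * t^-1.
Proof.
apply: (mulIg t); apply: (mulgI (p * t)).
by rewrite mulgVK !mulgA mulgK pp -[RHS]pt3 !expgS expg0 mulg1 !mulgA.
Qed.

Let zV : z^-1 = t * t * p.
Proof. by apply: mulg1_eq; rewrite /z !mulgA !mulgVK pp. Qed.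

(** Being conjugate to [t], the element [z] inherits its exponent 6. *)
Lemma triangle_conj : p / t / t = t ^ (t * p * t^-1).
Proof.
rewrite conjgE !invgM invgK pV !mulgA mulgVK.
have -> : t * p * t * p * t^-1 = t * (p * t * p) * t^-1 by rewrite !mulgA.
by rewrite ptp !mulgA mulgV mul1g.
Qed.

Lemma triangle_expg6 : (p / t / t) ^+ 6 = 1.
Proof. by rewrite triangle_conj -conjXg t6 conj1g. Qed.

Let t3 : t * t * t = t^-1 * t^-1 * t^-1.
Proof.
apply: (mulIg t); apply: (mulIg t); apply: (mulIg t).
by rewrite !mulgVK mulVg -t6 !expgS expg0 mulg1 !mulgA.
Qed.

(** In the plane [t^3] and [p] are half-turns, so their product is a translation. *)
Let eE : e = t * t * t * p. Proof. by rewrite /e zV !mulgA. Qed.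

Let e1E : e ^ z^-1 = t^-1 * t^-1 * p * t^-1.
Proof.
rewrite conjgE invgK eE zV /z !mulgA !mulgVK.
have -> : p * t * p * t * t * p = (p * t * p) * t * t * p by [].
rewrite ptp mulgVK; have -> : t^-1 * p * t * p = t^-1 * (p * t * p).
  by rewrite !mulgA.
by rewrite ptp !mulgA.
Qed.

Let e2E : (e ^ z^-1) ^ z^-1 = t^-1 * p * t^-1 * t^-1.
Proof.
rewrite e1E conjgE invgK zV /z !mulgA mulgVK.
have -> : p * t^-1 * t^-1 * t^-1 * t^-1 * p * t * p =
   p * (t^-1 * t^-1 * t^-1) * t^-1 * (p * t * p) by rewrite !mulgA.
rewrite -t3 ptp !mulgA mulgK.
have -> : p * t * t * t^-1 * p * t^-1 = p * t * p * t^-1 by rewrite mulgK.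
by rewrite ptp.
Qed.

Lemma triangle_translations_commute : commute (t / z) ((t / z) ^ z^-1).
Proof.
rewrite /commute -/e e1E eE !mulgA.
have -> : t^-1 * t^-1 * p * t^-1 * t * t * t * p =
  t^-1 * t^-1 * (p * t * p) * (p * t * p).
  by rewrite !mulgA mulgVK pK.
by rewrite t3 ptp !mulgA.
Qed.

(** This is [w^2 = w - 1] applied to [e], in multiplicative notation. *)
Lemma triangle_translations_rec :
  ((t / z) ^ z^-1) ^ z^-1 = (t / z) ^ z^-1 / (t / z).
Proof.
apply: (mulIg e); rewrite mulgVK e2E e1E eE !mulgA !mulgVK.
have -> : t^-1 * p * t * p = t^-1 * (p * t * p) by rewrite !mulgA.
by rewrite ptp !mulgA.
Qed.
End EuclideanTriangle.

(** * Recognizing the square of a cyclic group *)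

Section CyclicSquare.
Variables (H : groupType) (a b : H) (q : nat).
Hypotheses (q_gt0 : (0 < q)%N) (ab : commute a b).
Hypotheses (aq : a ^+ q = 1) (bq : b ^+ q = 1).
Hypothesis gen_ab : forall x, exists i j, x = a ^+ i * b ^+ j.
Hypothesis free_ab : forall i j,
  a ^+ i * b ^+ j = 1 -> (q %| i)%N /\ (q %| j)%N.

Let expg_modq (x : H) n : x ^+ q = 1 -> x ^+ (n %% q.-1.+1) = x ^+ n.
Proof.
rewrite prednK // => xq.
by rewrite [in RHS](divn_eq n q) expgnDr mulnC expgnA xq expg1n mul1g.
Qed.

Let F (u : cyclic_group q * cyclic_group q) : H := a ^+ u.1 * b ^+ u.2.

Let F_morph : {morph F : u v / u * v}.
Proof.
move=> u v; rewrite /F /= !expg_modq // !expgnDr !mulgA.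
by congr (_ * _); rewrite -!mulgA; congr (_ * _); apply: commuteX2.
Qed.

Let F_inj : injective F.
Proof.
move=> u v Fuv; have /eqP := Fuv; rewrite -divg_eq1 => /eqP Fuv1.
have {Fuv1} : a ^+ (u.1 + (q - v.1)) * b ^+ (u.2 + (q - v.2)) = 1.
  (* Exponents being natural, [q - i] plays the role of [-i]. *)
  have ltq (i : 'I_q.-1.+1) : (i <= q)%N by have := ltn_ord i; lia.
  have ex (x : H) (i : 'I_q.-1.+1) : x ^+ q = 1 -> x ^+ (q - i) = x ^- i.
    by move=> xq; rewrite expgnFr ?ltq // xq mul1g.
  rewrite !expgnDr !ex // -Fuv1 /F invgM -!mulgA; congr (_ * _).
  have ab' j : commute (a ^- v.1) (b ^+ j).
    by apply/commute_sym/commuteV/commuteX2/commute_sym.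
  by rewrite [RHS]mulgA; apply: commuteM => //; apply: commuteV.
move/free_ab=> [q1 q2]; case: u v q1 q2 {Fuv} => u1 u2 [v1 v2] /= q1 q2.
have eq_ord (i j : 'I_q.-1.+1) : (q %| i + (q - j))%N -> i = j.
  move=> qij; apply: val_inj => /=.
  (* The sum [i + (q - j)] lies strictly between 0 and [2q], so it must be [q]. *)
  have := ltn_ord i; have := ltn_ord j; case/dvdnP: qij => [[|[|r]]]; nia.
by congr pair; apply: eq_ord.
Qed.

Lemma isomorphic_cyclic_square :
  isomorphic H (cyclic_group q * cyclic_group q)%type.
Proof.
have F_surj x : exists u, F u == x.
  have [i [j ->]] := gen_ab x.
  have ltq n : (n %% q.-1.+1 < q.-1.+1)%N by rewrite ltn_pmod.
  by exists (Ordinal (ltq i), Ordinal (ltq j)); rewrite /F /= !expg_modq.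
pose f x := xchoose (F_surj x).
have fK : cancel f F by move=> x; apply/eqP/(xchooseP (F_surj x)).
have Ff : cancel F f by move=> u; apply: F_inj; apply: fK.
by exists f; [move=> x y; apply: F_inj; rewrite F_morph !fK | exists F].
Qed.
End CyclicSquare.

(** * Properties inherited from generators *)

Section GeneratedTheory.
Variables (G : groupType) (S : G -> Prop).

Lemma generatedX x n : generated S x -> generated S (x ^+ n).
Proof.
move=> Sx; elim: n => [|n IH]; first exact: generated1.
by rewrite expgS; apply: generatedM.
Qed.

Lemma generated_commute :
  (forall u v, S u -> S v -> commute u v) ->
  forall u v, generated S u -> generated S v -> commute u v.
Proof.
move=> Sc u v Su Sv; elim: Su => {u} [u Su||u u' _ uv _ u'v].
- elim: Sv => {v} [v Sv||v v' _ uv _ uv']; first exact: Sc.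
    exact: commute1.
  by apply: commuteM => //; apply: commuteV.
- exact/commute_sym/commute1.
- apply/commute_sym/commuteM; first exact/commute_sym.
  exact/commuteV/commute_sym.
Qed.

Lemma generatedJ g :
  (forall u, S u -> generated S (u ^ g)) ->
  forall u, generated S u -> generated S (u ^ g).
Proof.
move=> Sg u; elim=> {u} [u /Sg //||u v _ Su _ Sv].
  by rewrite conj1g; apply: generated1.
by rewrite conjMg conjVg; apply: generated_div.
Qed.
End GeneratedTheory.

(** * The translation lattice as a cyclic Z[w]-module, and its exponent *)

Section Lattice.
Variables (G : groupType) (t z c : G).
Hypotheses (t6 : t ^+ 6 = 1) (zt2 : (z * t ^+ 2) ^+ 2 = 1).
Hypotheses (zt3 : (z * t ^+ 3) ^+ 3 = 1) (zc : commute z c).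
Hypothesis zt3c : (z * t ^+ 3) ^ c = t ^- 2.

Let e0 := t / z.
Let e1 := e0 ^ z^-1.

(** Two generators suffice for a cyclic Z[w]-module, as 1 and w span Z[w] over Z. *)
Definition lattice := generated (fun x => x = t / z \/ x = (t / z) ^ z^-1).

Let p := z * t ^+ 2.
Let pt3 : (p * t) ^+ 3 = 1. Proof. by rewrite -mulgA -expgSr. Qed.
Let zE : p / t / t = z. Proof. by rewrite /p expg2 mulgA !mulgK. Qed.

Lemma rotation_expg6 : z ^+ 6 = 1.
Proof. by have := triangle_expg6 t6 zt2 pt3; rewrite zE. Qed.

Let e01 : commute e0 e1.
Proof. by have := triangle_translations_commute t6 zt2 pt3; rewrite zE. Qed.

Let e1z : e1 ^ z^-1 = e1 / e0.
Proof. by have := triangle_translations_rec t6 zt2 pt3; rewrite zE. Qed.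

Let lat0 : lattice e0. Proof. by apply: generated_in; left. Qed.
Let lat1 : lattice e1. Proof. by apply: generated_in; right. Qed.

Lemma lattice_commute u v : lattice u -> lattice v -> commute u v.
Proof.
apply: generated_commute => {u v} _ _ [] -> [] -> //; exact: commute_sym.
Qed.

Lemma latticeJzV v : lattice v -> lattice (v ^ z^-1).
Proof.
apply: generatedJ => _ [] ->; first exact: lat1.
by rewrite e1z; apply: generated_div.
Qed.

Lemma latticeJz v : lattice v -> lattice (v ^ z).
Proof.
(* As [z ^+ 6 = 1], stability under [z^-1] implies stability under [z]. *)
have zE5 : z = z^-1 ^+ 5.
  rewrite expVgn; apply/esym/mulg1_eq.
  by rewrite -[RHS]rotation_expg6 [RHS]expgSr.
rewrite {}zE5; elim: 5%N => [|n IH] lv; first by rewrite conjg1.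
by rewrite expgSr conjgM; apply/latticeJzV/IH.
Qed.

(** The relation [w^2 = w - 1] passes from the generators to all of the lattice because the lattice
    is abelian. *)
Lemma latticeJJzV v : lattice v -> (v ^ z^-1) ^ z^-1 = v ^ z^-1 / v.
Proof.
move=> lv; suff [] : lattice v /\ (v ^ z^-1) ^ z^-1 = v ^ z^-1 / v by [].
elim: lv => {v} [_ [] ->||u w _ [lu uE] _ [lw wE]].
- by split; [exact: lat0 | exact: e1z].
- split; first exact: lat1.
  by change ((e1 ^ z^-1) ^ z^-1 = e1 ^ z^-1 / e1); rewrite {1}e1z conjMg conjVg.
- by split; [apply: generated1 | rewrite !conj1g invg1 mulg1].
split; first exact: generated_div.
rewrite conjMg conjVg (conjMg (u ^ z^-1)) (conjVg (w ^ z^-1)) uE wE.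
move: (u ^ z^-1) (w ^ z^-1) (latticeJzV lw) => {uE wE} u' w' lw'.
rewrite !invgM !invgK -!mulgA; congr (_ * _).
rewrite (lattice_commute (generatedV lu) (generatedM lw (generatedV lw'))).
by rewrite (lattice_commute lw (generatedV lw')) mulgA.
Qed.

(** [w^3 = w^2 - w = -1]. *)
Lemma latticeJz3V v : lattice v -> v ^ (z^-1 ^+ 3) = v^-1.
Proof.
move=> lv; have lzv := latticeJzV lv.
rewrite !expgSr expg0 mul1g !conjgM latticeJJzV // (latticeJJzV lv).
move: (v ^ z^-1) lzv => u lu.
by rewrite -mulgA (lattice_commute (generatedV lv) (generatedV lu)) mulVKg.
Qed.

(* With w acting as v |-> v ^ z^-1: conjugation by c^-1 maps (1 + w)v to 2wv. *)
Lemma lattice_relator v :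
  lattice v -> (v * v ^ z^-1) ^ c^-1 = (v ^ z^-1) ^+ 2.
Proof.
have zVcV : commute z^-1 c^-1.
  by apply/commuteV/commute_sym/commuteV/commute_sym.
(* Telescoping gives [e0 * e1 = t^2 z^-2], which [c^-1] carries to [t^-3 z^-3]; and
   [e1^2 = e0 * e1 * (e1 / e0)] telescopes to [t^3 z^-3]. *)
have e0c : (e0 * e1) ^ c^-1 = e1 ^+ 2.
  have -> : e0 * e1 = t ^+ 2 / z / z.
    by rewrite /e1 /e0 conjgE invgK expg2 !mulgA mulgVK.
  have tc : (t ^+ 2) ^ c^-1 = (z * t ^+ 3)^-1.
    by rewrite -[t ^+ 2]invgK -zt3c conjVg conjgK.
  have zVc : z^-1 ^ c^-1 = z^-1 by rewrite conjgE invgK zVcV mulVKg.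
  have -> : e1 ^+ 2 = t * t * t / z / z / z.
    have -> : e1 ^+ 2 = e0 * e1 * e1 ^ z^-1.
      rewrite e1z; move: (e0) (e1) e01 => a b ab.
      by rewrite ab -mulgA (mulgA a) ab mulgK.
    by rewrite /e1 /e0 !conjgE !invgK !mulgA !mulgVK.
  have tV3 : t * t * t = t ^- 3.
    have <- : t ^+ 3 = t * t * t by rewrite !expgS expg0 mulg1 mulgA.
    by apply/esym/mulg1_eq; rewrite -expgnDr t6.
  by rewrite (conjMg _ z^-1) (conjMg (t ^+ 2)) zVc tc tV3 invgM.
move=> lv.
elim: lv => {v} [_ [] ->||u w lu uE lw wE].
- exact: e0c.
- change ((e1 * e1 ^ z^-1) ^ c^-1 = (e1 ^ z^-1) ^+ 2).
  by rewrite -conjMg -conjgM zVcV conjgM e0c conjXg.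
- by rewrite !conj1g mulg1 conj1g expg1n.
have lzu := latticeJzV lu; have lzw := latticeJzV lw.
have -> : u / w * (u / w) ^ z^-1 = (u * u ^ z^-1) / (w * w ^ z^-1).
  rewrite conjMg conjVg; move: (u ^ z^-1) (w ^ z^-1) lzu lzw => u' w' lu' lw'.
  rewrite invgM -!mulgA; congr (_ * _).
  rewrite (lattice_commute (generatedV lw') (generatedV lw)) mulgA.
  by rewrite (lattice_commute (generatedV lw) lu') -mulgA.
rewrite conjMg conjVg uE wE (conjMg u) (conjVg w) {uE wE}.
move: (u ^ z^-1) (w ^ z^-1) lzu lzw => u' w' lu' lw'.
by rewrite expgMn ?expVgn //; apply: lattice_commute lu' (generatedV lw').
Qed.

(** The action of [1 + w]. *)
Let delta v := v * v ^ z^-1.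

Let lat_delta v : lattice v -> lattice (delta v).
Proof. by move=> lv; apply: generatedM => //; apply: latticeJzV. Qed.

(* (1 + w)^2 = 3w *)
Let delta2 v : lattice v -> delta (delta v) = (v ^ z^-1) ^+ 3.
Proof.
move=> lv; rewrite /delta conjMg latticeJJzV //.
move: (v ^ z^-1) (latticeJzV lv) => u lu.
rewrite [RHS]expgS expg2.
have -> : v * u * (u * (u / v)) = v * (u * (u * u)) / v by rewrite !mulgA.
have luuu : lattice (u * (u * u)) by do 2!apply: generatedM => //.
by rewrite (lattice_commute lv luuu) mulgK.
Qed.

(** As [c] commutes with [z], its action commutes with w, so each factor [1 + w] in turn becomes
    [2w]. *)
Lemma lattice_iter_relator j v : lattice v ->
  (iter j delta v) ^ (c^-1 ^+ j) = (v ^ (z^-1 ^+ j)) ^+ (2 ^ j).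
Proof.
elim: j v => [|j IH] v lv; first by rewrite !conjg1 expg1.
rewrite iterSr [c^-1 ^+ _]expgSr conjgM IH; last exact: lat_delta.
rewrite conjXg -conjgM.
have -> : z^-1 ^+ j * c^-1 = c^-1 * z^-1 ^+ j.
  apply/commute_sym/commuteX/commuteV/commute_sym/commuteV/commute_sym.
  exact: commute_sym.
by rewrite conjgM lattice_relator // conjXg -expgnA -expnS -conjgM -expgS.
Qed.

Lemma lattice_iter_delta j v : lattice v ->
  iter (2 * j) delta v = (v ^ (z^-1 ^+ j)) ^+ (3 ^ j).
Proof.
elim: j v => [|j IH] v lv; first by rewrite conjg1 expg1.
rewrite (_ : 2 * j.+1 = (2 * j).+2)%N ?mulnS // !iterSr IH; last first.
  by do 2!apply: lat_delta.
by rewrite delta2 // !conjXg -expgnA -expnS -conjgM -expgS.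
Qed.

Variables (h k l : nat).
Hypotheses (h_gt0 : (0 < h)%N) (kE : k = (h + 3 * l)%N).
Hypothesis cz : c ^+ (2 * h) = z ^+ k.

(** With [m = 2h] one has [m - 2k = -6l], so the parity of [l] separates the residues 0 and 6 modulo
    12. *)
Definition order6 := (if odd l then 4 ^ h + 3 ^ h else 4 ^ h - 3 ^ h)%N.

Lemma lattice_exponent v : lattice v -> v ^+ order6 = 1.
Proof.
move=> lv; apply: (conjg_inj (z^-1 ^+ (2 * h))); rewrite conj1g conjXg.
(* Put [u = w^(2h) v]. Computing [(1 + w)^(2h) v] conjugated by [c^(-2h) = z^(-k)] in two ways gives
   [3^h w^(3l) u = 4^h u], where [w^3 = -1]. *)
have := lattice_iter_relator (2 * h) lv.
have lJX n : lattice (v ^ (z^-1 ^+ n)).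
  elim: n => [|n IH]; first by rewrite conjg1.
  by rewrite expgSr conjgM; apply: latticeJzV.
rewrite lattice_iter_delta // (expVgn c) cz -(expVgn z) conjXg -conjgM -expgnDr.
have -> : (h + k = 2 * h + 3 * l)%N by rewrite kE; lia.
rewrite [z^-1 ^+ (2 * h + _)]expgnDr conjgM expnM.
move: (v ^ _) (lJX (2 * h)%N) => w lw; rewrite (_ : (2 ^ 2 = 4)%N) // => wE.
have wl : w ^ (z^-1 ^+ (3 * l)) = if odd l then w^-1 else w.
  elim: (l) => [|n IH]; first by rewrite conjg1.
  rewrite mulnS addnC expgnDr conjgM IH /=; case: (odd n) => /=.
    by rewrite latticeJz3V ?invgK //; apply: generatedV.
  by rewrite latticeJz3V.
move: wE; rewrite wl /order6; case: (odd l) => wE.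
  by rewrite expgnDr -wE expVgn mulVg.
by rewrite expgnFr ?leq_exp2r // -wE mulgV.
Qed.

Lemma order6_gt0 : (0 < order6)%N.
Proof.
by rewrite /order6; case: ifP => _;
  rewrite ?subn_gt0 ?ltn_exp2r ?addn_gt0 ?expn_gt0.
Qed.

(** As [h > 0], [order6] is congruent to [4^h], hence to 1, modulo 3. *)
Let coprime3 : coprime 3 order6.
Proof.
rewrite /order6; case: (h) h_gt0 => // n _; rewrite !expnS.
have : (4 ^ n %% 3 = 1)%N by rewrite -modnXm exp1n.
rewrite prime_coprime //; have := leq_exp2r 3 4 (ltn0Sn n).
rewrite !expnS; case: ifP => _; lia.
Qed.

Lemma latticeJcV v : lattice v -> lattice (v ^ c^-1).
Proof.
move=> lv; case: (egcdnP order6 (isT : (0 < 3)%N)) => km kn kE' _.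
(* Here [3 * km] is 1 modulo the exponent, so [v = 3 km v = (1 + w)^2 w^-1 km v] is in the image of
   [1 + w], where the relator determines conjugation by [c^-1]. *)
have vE : v = delta (delta ((v ^+ km) ^ z)).
  rewrite delta2; last by apply/latticeJz/generatedX.
  rewrite conjgK -expgnA kE' (eqnP coprime3) addn1 expgS.
  by rewrite mulnC expgnA lattice_exponent // expg1n mulg1.
rewrite vE {1}/delta lattice_relator; last exact/lat_delta/latticeJz/generatedX.
exact/generatedX/latticeJzV/lat_delta/latticeJz/generatedX.
Qed.
End Lattice.

(** * The triangle relations extracted from the relator *)

Section Relator.
Variables (G : groupType) (t z c : G).
Hypotheses (t6 : t ^+ 6 = 1) (zc : commute z c).
Hypothesis rel : z * c^-1 * t ^+ 3 * c * t ^+ 2 = 1.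

Lemma relator_conj : (z * t ^+ 3) ^ c = t ^- 2.
Proof.
apply: (mulIg (t ^+ 2)); rewrite mulVg -[RHS]rel conjgE.
by rewrite (mulgA c^-1) (mulgA c^-1) (commuteV zc).
Qed.

(** A conjugate of [z * t ^+ 3] is [t ^- 2], whose cube is trivial. *)
Lemma relator_expg3 : (z * t ^+ 3) ^+ 3 = 1.
Proof.
apply: (conjg_inj c); rewrite conjXg relator_conj conj1g expVgn -expgnA.
by rewrite t6 invg1.
Qed.

(** The relator also makes [t ^+ 2 * z], a conjugate of [z * t ^+ 2], the inverse of a conjugate of
    [t ^+ 3]. *)
Lemma relator_expg2 : (z * t ^+ 2) ^+ 2 = 1.
Proof.
have relJ : (t ^+ 3) ^ c = (t ^+ 2 * z)^-1.
  apply: (mulgI z); apply: (mulIg (t ^+ 2)).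
  by rewrite conjgE invgM mulVKg mulVg -[RHS]rel (mulgA z) (mulgA (z / c)).
have -> : z * t ^+ 2 = (t ^+ 2 * z) ^ (t ^+ 2).
  by rewrite conjgE -(mulgA _ z) mulKg.
rewrite -conjXg -[t ^+ 2 * z]invgK -relJ -conjVg -(conjXg _ c) expVgn.
by rewrite -expgnA t6 invg1 !conj1g.
Qed.

End Relator.

(** * The derived subgroup is the lattice *)

Section Metabelian.
Variables (G : groupType) (t y : G) (h k l : nat).
Hypotheses (gen_ty : forall x, generated (fun g => g = t \/ g = y) x).
Hypotheses (h_gt0 : (0 < h)%N) (kE : k = (h + 3 * l)%N).
Hypothesis co_mk : coprime (2 * h) k.
Hypotheses (t6 : t ^+ 6 = 1).
Hypothesis rel :
  y ^+ (2 * h) * (y ^+ k)^-1 * t ^+ 3 * y ^+ k * t ^+ 2 = 1.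

Let z := y ^+ (2 * h).
Let c := y ^+ k.

Let zc : commute z c. Proof. exact/commuteX2/commute_refl. Qed.

Let zt3c := relator_conj zc rel.
Let zt3 := relator_expg3 t6 zc rel.
Let zt2 := relator_expg2 t6 rel.

Let z6 : z ^+ 6 = 1.
Proof. exact: rotation_expg6 t6 zt2 zt3. Qed.

Let lat := lattice t z.

Let cz : c ^+ (2 * h) = z ^+ k.
Proof. by rewrite -!expgnA mulnC. Qed.

Let latJyV v : lat v -> lat (v ^ y^-1).
Proof.
case: (egcdnP (2 * h) (_ : 0 < k)%N); first by rewrite kE addn_gt0 h_gt0.
move=> a b; rewrite gcdnC (eqnP co_mk) => ab _.
(* From the Bezout relation [ak = 2hb + 1]. *)
have -> : y^-1 = c^-1 ^+ a * z ^+ b.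
  rewrite expVgn -!expgnA [(k * a)%N]mulnC ab addn1 expgSr invgM -mulgA.
  by rewrite [(2 * h * b)%N]mulnC mulVg mulg1.
move=> lv; rewrite conjgM.
have {lv}: lat (v ^ (c^-1 ^+ a)).
  elim: a {ab} => [|a IH]; first by rewrite conjg1.
  by rewrite expgSr conjgM; apply: (latticeJcV t6 zt2 zt3 zc zt3c h_gt0 kE cz).
move: (v ^ _) => w; elim: b {ab} w => [|b IH] w lw; first by rewrite conjg1.
by rewrite expgSr conjgM; apply: (latticeJz t6 zt2 zt3); apply: IH.
Qed.

Let latJyVX v i : lat v -> lat (v ^ (y^-1 ^+ i)).
Proof.
move=> lv; elim: i => [|i IH]; first by rewrite conjg1.
by rewrite expgSr conjgM; apply: latJyV.
Qed.

(** Modulo the lattice, which [y] normalizes, [t] equals the power [z] of [y]; the quotient is thus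
    cyclic. *)
Lemma J6_normal_form x : exists2 v, lat v & exists i, x = v * y ^+ i.
Proof.
elim: (gen_ty x) => {x} [_ [] ->||_ _ _ [u lu [i ->]] _ [v lv [j ->]]].
- exists (t / z); first by apply: generated_in; left.
  by exists (2 * h)%N; rewrite mulgVK.
- by exists 1; [apply: generated1 | exists 1%N; rewrite mul1g].
- by exists 1; [apply: generated1 | exists 0%N; rewrite mul1g].
(* [z ^+ 6 = 1] reads [y ^+ (12 * h) = 1], so nonnegative exponents are enough. *)
have yV : y ^- j = y ^+ (j * (12 * h).-1).
  apply: mulg1_eq; rewrite -expgnDr -mulnS prednK ?muln_gt0 //.
  rewrite mulnC expgnA (_ : 12 * h = 2 * h * 6)%N; last lia.
  by rewrite expgnA z6 expg1n.
set r := (i + j * (12 * h).-1)%N.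
exists (u * (v^-1 ^ (y^-1 ^+ r))).
  by apply: generatedM => //; apply/latJyVX/generatedV.
exists r; rewrite invgM mulgA -(mulgA u) yV -expgnDr -/r.
by rewrite conjgE expVgn invgK -!mulgA mulVg mulg1.
Qed.

Let lat_e0 : lat (t / z). Proof. by apply: generated_in; left. Qed.
Let lat_e1 : lat ((t / z) ^ z^-1). Proof. by apply: generated_in; right. Qed.

Lemma J6_derivedP x : x \in @derived G <-> lat x.
Proof.
split=> [/asboolP|lx].
  elim=> {x} [_ [a [b ->]]||u v _ lu _ lv]; first 1 last.
  - exact: generated1.
  - exact: generated_div.
  have [u lu [i aE]] := J6_normal_form a^-1.
  have [v lv [j bE]] := J6_normal_form b^-1.
  (* Exponents of [y] add up in a product of normal forms, so [a^-1 * b^-1] and [b^-1 * a^-1] end in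
     the same power of [y], which cancels in the commutator. *)
  have swap w w' n n' : lat w -> lat w' -> exists2 w'', lat w'' &
      (w * y ^+ n) * (w' * y ^+ n') = w'' * y ^+ (n + n').
    move=> lw lw'; exists (w * (w' ^ (y^-1 ^+ n))).
      by apply: generatedM => //; apply: latJyVX.
    by rewrite conjgE expVgn invgK expgnDr !mulgA mulgVK.
  have [w1 lw1 ab] := swap u v i j lu lv.
  have [w2 lw2 ba] := swap v u j i lv lu.
  have -> : [~ a, b] = (a^-1 * b^-1) / (b^-1 * a^-1).
    by rewrite invgM !invgK commgEl conjgE !mulgA.
  rewrite aE bE ab ba addnC invgM mulgA mulgK.
  exact: generated_div.
have derR a b : [~ a, b] \in @derived G.
  by apply/asboolP/generated_in; exists a, b.
have derM u v : u \in @derived G -> v \in @derived G -> u * v \in @derived G.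
  by move=> /asboolP du /asboolP dv; apply/asboolP/generatedM.
have derJ u g : u \in @derived G -> u ^ g \in @derived G.
  by move=> du; rewrite -[u ^ g](mulVKg u) -commgEl derM.
(* For [e = t / z], the element [w^2 e = (w - 1)e] is a commutator; conjugating it by [z] once and
   twice yields both generators of the lattice. *)
have /derJ-/(_ z) : ((t / z) ^ z^-1) ^ z^-1 \in @derived G.
  rewrite (latticeJJzV t6 zt2 zt3) //.
  have -> : (t / z) ^ z^-1 / (t / z) = [~ z^-1, (t / z)^-1].
    by rewrite commgEl !conjgE !invgK !mulgA.
  exact: derR.
rewrite conjgKV => d1; have := derJ _ z d1; rewrite conjgKV => d0.
elim: lx => {x} [_ [] -> //||u v _ du _ dv].
- by apply/asboolP/generated1.
- by move: du dv => /asboolP du /asboolP dv; apply/asboolP/generated_div.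
Qed.

(** The premise says that the two generators are independent modulo the exponent. It bounds the
    lattice from below and is to be obtained from a concrete model. *)
Lemma J6_derived_isomorphic :
  (forall i j, (t / z) ^+ i * ((t / z) ^ z^-1) ^+ j = 1 ->
     (order6 h l %| i)%N /\ (order6 h l %| j)%N) ->
  isomorphic (derived_subgroup G)
    (cyclic_group (order6 h l) * cyclic_group (order6 h l))%type.
Proof.
move=> free_e.
have expq v : lat v -> v ^+ order6 h l = 1.
  exact: (lattice_exponent t6 zt2 zt3 zc zt3c h_gt0 kE cz).
have q_gt0 := order6_gt0 l h_gt0.
pose a : derived_subgroup G :=
  exist (fun x => x \in @derived G) _ ((J6_derivedP _).2 lat_e0).
pose b : derived_subgroup G :=
  exist (fun x => x \in @derived G) _ ((J6_derivedP _).2 lat_e1).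
have valab i j : val (a ^+ i * b ^+ j) =
    (t / z) ^+ i * ((t / z) ^ z^-1) ^+ j :> G.
  by rewrite valM !gmulfXn.
apply: (@isomorphic_cyclic_square _ a b) => //.
- by apply: val_inj; rewrite !valM; apply: (lattice_commute t6 zt2 zt3).
- by apply: val_inj; rewrite gmulfXn expq.
- by apply: val_inj; rewrite gmulfXn expq.
- move=> [x dx]; have /J6_derivedP lx := dx.
  suff [i [j xE]] : exists i j, x = (t / z) ^+ i * ((t / z) ^ z^-1) ^+ j.
    by exists i, j; apply: val_inj; rewrite valab.
  elim: lx => {x dx} [_ [] ->||u v _ [i [j ->]] _ [i' [j' ->]]].
  + by exists 1%N, 0%N; rewrite mulg1.
  + by exists 0%N, 1%N; rewrite mul1g.
  + by exists 0%N, 0%N; rewrite mulg1.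
  have e01 := lattice_commute t6 zt2 zt3 lat_e0 lat_e1.
  have VE x n : lat x -> x ^- n = x ^+ (n * (order6 h l).-1).
    move=> lx; apply: mulg1_eq; rewrite -expgnDr -mulnS prednK //.
    by rewrite mulnC expgnA expq // expg1n.
  exists (i + i' * (order6 h l).-1)%N, (j + j' * (order6 h l).-1)%N.
  rewrite !expgnDr -!VE // invgM -!mulgA; congr (_ * _).
  move: (t / z) (_ ^ _) e01 => e0 e1 e01; rewrite [LHS]mulgA.
  have ce n : commute (e0 ^- i') (e1 ^+ n).
    by apply/commute_sym/commuteV/commuteX2/commute_sym.
  by apply/commute_sym/commuteM => //; apply: commuteV.
- by move=> i j ab1; apply: free_e; rewrite -valab ab1 val1.
Qed.
End Metabelian.

(** * Universal properties of free groups and of quotients *)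

Section Lifting.
Variables (X : choiceType) (H : groupType) (f : X -> H).

Let letter (l : X * bool) : H := if l.2 then (f l.1)^-1 else f l.1.

Let eval (w : seq (X * bool)) : H := \prod_(l <- w) letter l.

Let eval_equiv u v : free_equiv u v -> eval u = eval v.
Proof.
elim=> {u v} [u v x b|u|u v _ -> //|u v w _ -> _ -> //] //.
rewrite /eval !big_cat !big_cons /=; congr (_ * _); rewrite mulgA /letter /=.
by case: b; rewrite /= ?mulgV ?mulVg mul1g.
Qed.

Definition free_lift (x : free_group X) : H := eval (repr x).

Lemma free_lift_gen x : free_lift (free_gen x) = f x.
Proof.
by rewrite /free_lift (eval_equiv (free_reprP _)) /eval big_seq1.
Qed.

Lemma free_liftM : {morph free_lift : x y / x * y}.
Proof.
move=> x y; rewrite /free_lift (eval_equiv (free_reprP _)).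
by rewrite /eval big_cat.
Qed.
End Lifting.

Section Morphisms.
Variables (G H : groupType) (f : G -> H).
Hypothesis fM : {morph f : x y / x * y}.

Lemma morph1 : f 1 = 1.
Proof. by apply: (mulgI (f 1)); rewrite -fM !mulg1. Qed.

Lemma morphV : {morph f : x / x^-1}.
Proof. by move=> x; apply/esym/mulg1_eq; rewrite -fM mulgV morph1. Qed.

Lemma morphX n : {morph f : x / x ^+ n}.
Proof.
by move=> x; elim: n => [|n IH]; rewrite ?morph1 // !expgS fM IH.
Qed.

Lemma morph_expgz n : {morph f : x / expgz x n}.
Proof. by case: n => n x; rewrite /= ?morphV morphX. Qed.

Variable R : G -> Prop.
Hypothesis fR : forall r, R r -> f r = 1.

Definition quotient_lift (x : quotient_group R) : H := f (repr x).

Let f_normal_closure x : normal_closure R x -> f x = 1.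
Proof.
elim=> {x} [_ [r [g [Rr ->]]]||u v _ fu _ fv]; last 2 first.
- exact: morph1.
- by rewrite fM morphV fu fv mulgV.
by rewrite conjgE !fM (fR Rr) mul1g -fM mulVg morph1.
Qed.

Lemma quotient_lift_pi x : quotient_lift (\pi_(quotient_group R) x) = f x.
Proof.
apply: divg1_eq; rewrite -morphV -fM; apply: f_normal_closure.
exact: quo_reprP.
Qed.

Lemma quotient_liftM : {morph quotient_lift : x y / x * y}.
Proof.
by move=> x y; rewrite -[x * y]/(\pi_(quotient_group R) (repr x * repr y))
  quotient_lift_pi fM.
Qed.
End Morphisms.

Lemma quotient_piM (G : groupType) (R : G -> Prop) :
  {morph \pi_(quotient_group R) : x y / x * y}.
Proof. by move=> x y; rewrite -quo_mulE. Qed.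

Lemma free_group_generated (X : choiceType) (x : free_group X) :
  generated (fun g => exists a, g = free_gen a) x.
Proof.
rewrite -[x]reprK; elim: (repr x) => [|[a b] w IH]; first exact: generated1.
have -> : \pi_(free_group X) ((a, b) :: w) =
    \pi_(free_group X) [:: (a, b)] * \pi_(free_group X) w.
  by rewrite -[RHS]/(free_mul _ _) free_mulE.
apply: generatedM => //; have ga : generated (fun g => exists a, g = free_gen a)
    (free_gen a) by apply: generated_in; exists a.
case: b => //; have -> : \pi_(free_group X) [:: (a, true)] = (free_gen a)^-1.
  by rewrite -[RHS]/(free_inv _) free_invE.
exact: generatedV.
Qed.

(** * Generators, relations and morphisms of [J6] *)

Section J6Presentation.
Variables m k : int.

Definition J6t : J6 m k :=
  \pi_(quotient_group (J6_relator m k)) (free_gen false).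
Definition J6y : J6 m k :=
  \pi_(quotient_group (J6_relator m k)) (free_gen true).

Lemma J6_generated x : generated (fun g => g = J6t \/ g = J6y) x.
Proof.
rewrite -[x]reprK; elim: (free_group_generated (repr x)) => {x}.
- by move=> _ [[] ->]; apply: generated_in; [right | left].
- exact: generated1.
- move=> u v _ Gu _ Gv; rewrite (quotient_piM _ u v^-1).
  rewrite (morphV (@quotient_piM _ _)); exact: generated_div.
Qed.

Lemma J6_relator_pi r :
  J6_relator m k r -> \pi_(quotient_group (J6_relator m k)) r = 1.
Proof.
move=> Rr; apply/quo_piP; apply: generated_in; exists r, 1.
by rewrite invg1 mulg1 conjg1.
Qed.

Lemma J6_t6 : J6t ^+ 6 = 1.
Proof.
rewrite -(morphX (@quotient_piM _ _)); apply: J6_relator_pi.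
by left.
Qed.

Lemma J6_rel :
  expgz J6y (m - k)%R * J6t ^+ 3 * expgz J6y k * J6t ^+ 2 = 1.
Proof.
have piM := @quotient_piM _ (J6_relator m k).
rewrite -[RHS](J6_relator_pi (or_intror erefl)).
rewrite 3!(piM (_ * _), piM (expgz _ _)).
by rewrite !(morphX piM) !(morph_expgz piM).
Qed.

(** Von Dyck's theorem for this presentation. *)
Lemma J6_lift (H : groupType) (T Y : H) :
  T ^+ 6 = 1 -> expgz Y (m - k)%R * T ^+ 3 * expgz Y k * T ^+ 2 = 1 ->
  exists f : J6 m k -> H,
    [/\ {morph f : x y / x * y}, f J6t = T & f J6y = Y].
Proof.
move=> T6 rel; pose g b := if b then Y else T.
have gM := free_liftM g.
have gR r : J6_relator m k r -> free_lift g r = 1.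
  case=> ->; first by rewrite (morphX gM) free_lift_gen.
  by rewrite 3!(gM (_ * _), gM (expgz _ _)) !(morphX gM)
    !(morph_expgz gM) !free_lift_gen.
exists (quotient_lift (free_lift g) (R := J6_relator m k)).
by split; [apply: quotient_liftM | |]; rewrite ?quotient_lift_pi ?free_lift_gen.
Qed.
End J6Presentation.

(** * From integer to natural exponents *)

Section IntegerPowers.
Variables (G : groupType) (x : G).

Lemma expgzB (m : nat) (k : int) :
  expgz x (m%:Z - k)%R = x ^+ m * (expgz x k)^-1.
Proof.
case: k => k; last first.
  by rewrite NegzE opprK -PoszD /= invgK expgnDr.
have [km|mk] := leqP k m; first by rewrite subzn //= expgnFr.
have -> : (m%:Z - Posz k = Negz (k - m).-1)%R by lia.
have {2}-> : k = ((k - m).-1.+1 + m)%N by lia.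
by rewrite /= expgnDr invgM mulVKg.
Qed.

Lemma expgz_eqmod (n : nat) (k : int) (k' : nat) :
  x ^+ n = 1 -> (k = k'%:Z %[mod n%:Z])%Z -> expgz x k = x ^+ k'.
Proof.
move=> xn.
have x1 a b : (a = b %[mod n])%N -> x ^+ a = x ^+ b.
  have xE c : x ^+ c = x ^+ (c %% n).
    by rewrite {1}(divn_eq c n) expgnDr mulnC expgnA xn expg1n mul1g.
  by move=> ab; rewrite xE ab -xE.
case: k => k /= kk'; first by apply: x1; move: kk'; lia.
apply: mulg1_eq; rewrite -expgnDr -[RHS](expg0 x); apply: x1.
apply/eqP; rewrite mod0n -/(dvdn _ _).
by move/eqP: kk'; rewrite eqz_mod_dvd NegzE -opprD -PoszD dvdzE abszN addnC.
Qed.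

Lemma commute_expgz (k : int) n : commute (x ^+ n) (expgz x k).
Proof. by case: k => k /=; [|apply: commuteV]; apply: commuteX2. Qed.
End IntegerPowers.

(** * Eisenstein integers over a commutative ring *)

Section Eisenstein.
Variable R : comNzRingType.

(* The pair (a, b) stands for a + bw with w^2 = w - 1. *)
Definition eisenstein : Type := (R * R)%type.

HB.instance Definition _ := GRing.Zmodule.on eisenstein.

Local Open Scope ring_scope.

Definition eis_one : eisenstein := (1, 0).
Definition eis_mul (x y : eisenstein) : eisenstein :=
  (x.1 * y.1 - x.2 * y.2, x.1 * y.2 + x.2 * y.1 + x.2 * y.2).
Definition eis_w : eisenstein := (0, 1).

Lemma eis_mulA : associative eis_mul.
Proof. by move=> [a b] [c d] [e f]; congr pair => /=; ring. Qed.

Lemma eis_mulC : commutative eis_mul.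
Proof. by move=> [a b] [c d]; congr pair => /=; ring. Qed.

Lemma eis_mul1 : left_id eis_one eis_mul.
Proof. by move=> [a b]; congr pair => /=; ring. Qed.

Lemma eis_mulDl : left_distributive eis_mul +%R.
Proof. by move=> [a b] [c d] [e f]; congr pair => /=; ring. Qed.

Lemma eis_one_neq0 : eis_one != 0.
Proof. by apply/eqP => -[] /eqP; rewrite oner_eq0. Qed.

HB.instance Definition _ := GRing.Zmodule_isComNzRing.Build eisenstein
  eis_mulA eis_mulC eis_mul1 eis_mulDl eis_one_neq0.

Lemma eis_w2 : eis_w ^+ 2 = eis_w - 1.
Proof. by congr pair => /=; ring. Qed.

Lemma eis_mulrn (x : eisenstein) n : x *+ n = (x.1 *+ n, x.2 *+ n).
Proof. by elim: n => [|n IH] //; rewrite !mulrS IH. Qed.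
End Eisenstein.

HB.instance Definition _ (R : finComNzRingType) :=
  Finite.on (eisenstein R).

(** * A model by affine permutations of a finite ring *)

Section AffineModel.
Variable S : finComNzRingType.

Lemma affine_inj (u u' v : S) :
  (u * u' = 1)%R -> injective (fun x : S => x * u + v)%R.
Proof.
move=> uu' x1 x2 /addIr /(congr1 (fun x => x * u')%R).
by rewrite -!mulrA uu' !mulr1.
Qed.

(** The inverse [u'] of the slope supplies injectivity, enough for a permutation of a finite set. *)
Definition affine (u u' v : S) (uu' : (u * u' = 1)%R) : {perm S} :=
  perm (affine_inj (v := v) uu').

Lemma linear_expg (u u' : S) (uu' : (u * u' = 1)%R) n x :
  (affine 0%R uu' ^+ n) x = (x * GRing.exp u n)%R.
Proof.
rewrite permX; elim: n => [|n IH]; first by rewrite mulr1.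
by rewrite iterS IH permE addr0 exprSr mulrA.
Qed.

Definition translation (v : S) : {perm S} := affine v (mulr1 (1 : S)%R).

Lemma translation_expg v n x : (translation v ^+ n) x = (x + v *+ n)%R.
Proof.
rewrite permX; elim: n => [|n IH]; first by rewrite addr0.
by rewrite iterS IH permE mulr1 mulrSr addrA.
Qed.

Variables (w a : S) (h k : nat).
Hypotheses (w2 : GRing.exp w 2 = (w - 1)%R) (a2 : (a + a = 1 + w)%R).
Hypotheses (co_hk : coprime (2 * h) k) (h_gt0 : (0 < h)%N) (k_gt0 : (0 < k)%N).
Hypothesis a_exp : GRing.exp a (2 * h) = GRing.exp w k.

Let w3 : GRing.exp w 3 = (- 1)%R.
Proof. by rewrite exprS w2 mulrBr -expr2 w2; ring. Qed.

Let w6 : GRing.exp w 6 = 1%R.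
Proof. by rewrite (exprM w 3 2) w3; ring. Qed.

Lemma affine_root :
  exists2 b : S, GRing.exp b (2 * h) = w & GRing.exp b k = a.
Proof.
case: (egcdnP (2 * h) k_gt0) => i j; rewrite gcdnC (eqnP co_hk) => ij _.
(* This is [a^i w^(-j)], where [ik = 2hj + 1] and [w^5 = w^-1]. *)
exists (GRing.exp a i * GRing.exp w (5 * j))%R.
  rewrite exprMn -!exprM (mulnC i) exprM a_exp -exprM -exprD.
  rewrite (_ : k * i + _ = 6 * (j * (2 * h)) + 1)%N; last lia.
  by rewrite exprD exprM w6 expr1n mul1r.
rewrite exprMn -!exprM ij exprD expr1 (mulnC j) exprM a_exp -exprM mulrAC.
rewrite -exprD.
rewrite (_ : k * j + _ = 6 * (j * k))%N; last lia.
by rewrite exprM w6 expr1n mul1r.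
Qed.

(** [T] is [x |-> xw + 1], a rotation about [w], and [Y] is [x |-> xb]. Permutations compose from
    left to right, which makes the two translation vectors [w^-1 = 1 - w] and [w^-2 = -w]. *)
Lemma affine_model : exists T Y : {perm S},
  let z := Y ^+ (2 * h) in
  [/\ T ^+ 6 = 1, z ^+ 6 = 1, z * (Y ^+ k)^-1 * T ^+ 3 * Y ^+ k * T ^+ 2 = 1,
      T / z = translation (1 - w)%R & (T / z) ^ z^-1 = translation (- w)%R].
Proof.
have [b bw ba] := affine_root.
have bV : (b * GRing.exp b (12 * h).-1 = 1)%R.
  rewrite -exprS prednK ?muln_gt0 // (_ : 12 * h = 2 * h * 6)%N; last lia.
  by rewrite exprM bw w6.
have wV : (w * GRing.exp w 5 = 1)%R by rewrite -exprS.
exists (affine 1%R wV), (affine 0%R bV) => z.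
have zE x : z x = (x * w)%R by rewrite linear_expg bw.
(* In goals produced by [permE], [ring] does not recognize the operations of S
   inferred through its finite type; hence the identities E stated apart. *)
have TE x : affine 1%R wV x = (x * w + 1)%R by rewrite permE.
have T2E x : (affine 1%R wV ^+ 2) x = (x * (w - 1) + w + 1)%R.
  rewrite expg2 permM !TE; have E (y : S) : ((y * w + 1) * w + 1 =
    y * GRing.exp w 2 + w + 1)%R by ring.
  by rewrite E w2.
have T3E x : (affine 1%R wV ^+ 3) x = (w + w - x)%R.
  rewrite expgS permM T2E TE; have E (y : S) : ((y * w + 1) * (w - 1) + w + 1 =
    y * (GRing.exp w 2 - w) + w + w)%R by ring.
  rewrite E w2.
  have {}E (y : S) : (y * (w - 1 - w) + w + w = w + w - y)%R by ring.
  exact: E.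
have e0E : affine 1%R wV / z = translation (1 - w)%R.
  apply: (mulIg z); rewrite mulgVK; apply/permP => x.
  rewrite permM zE TE permE mulr1; have E (y : S) : ((y + (1 - w)) * w =
    y * w + w - GRing.exp w 2)%R by ring.
  rewrite E w2; have {}E (y : S) : (y * w + w - (w - 1) = y * w + 1)%R by ring.
  exact/esym/E.
split.
- apply/permP => x; rewrite (expgnA _ 3 2) expg2 permM !T3E perm1.
  have E (y : S) : (w + w - (w + w - y) = y)%R by ring.
  exact: E.
- by apply/permP => x; rewrite -expgnA linear_expg exprM bw w6 perm1 mulr1.
- set c := affine 0%R bV ^+ k.
  have cE x : c x = (x * a)%R by rewrite linear_expg ba.
  (* The relation conjugated by [z] and multiplied by [c], so that no inverse has to be
     evaluated. *)
  suff cT : affine 1%R wV ^+ 3 * (c * (affine 1%R wV ^+ 2 * z)) = c.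
    move: (affine _ _ ^+ 3) (affine _ _ ^+ 2) cT => T3 T2 cT.
    apply: (mulIg z); apply: (mulgI z^-1); apply: (mulgI c).
    by rewrite mul1g mulVg mulg1 -[RHS]cT -!mulgA mulKg mulVKg.
  move: (affine 1%R wV ^+ 3) (affine 1%R wV ^+ 2) T3E T2E => T3 T2 T3E T2E.
  apply/permP => x; rewrite !permM zE T2E cE T3E cE.
  have E (y : S) : (((w + w - y) * a * (w - 1) + w + 1) * w =
    (w + w - y) * a * (GRing.exp w 2 - w) + GRing.exp w 2 + w)%R by ring.
  rewrite E w2.
  have {}E (y : S) : ((w + w - y) * a * (w - 1 - w) + (w - 1) + w =
    y * a - w * (a + a) + w + w - 1)%R by ring.
  (* The value of [2a] is what makes the constant term vanish. *)
  rewrite E a2; have {}E (y : S) : (y * a - w * (1 + w) + w + w - 1 =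
    y * a - GRing.exp w 2 + w - 1)%R by ring.
  rewrite E w2; have {}E (y : S) : (y * a - (w - 1) + w - 1 = y * a)%R by ring.
  exact: E.
- exact: e0E.
- rewrite e0E conjgE invgK mulgA; apply: (mulIg z); rewrite mulgVK.
  apply/permP => x; rewrite !permM !zE !permE !mulr1.
  have E (y : S) : ((y - w) * w = y * w - GRing.exp w 2)%R by ring.
  by rewrite E w2 opprB.
Qed.
End AffineModel.

(** * The coefficients of the model, over Z[w] modulo q *)

Section EisensteinModel.
Variables h l : nat.
Let q := order6 h l.
Hypotheses (h_gt0 : (0 < h)%N) (q_gt1 : (1 < q)%N).

Local Open Scope ring_scope.
Let S : finComNzRingType := eisenstein 'Z_q.

Let w : S := eis_w 'Z_q.
Let half : S := (q.+1)./2%:R.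

Let qS : q%:R = 0 :> S.
Proof. by rewrite eis_mulrn /= pchar_Zp // mul0rn. Qed.

Let half2 : half + half = 1.
Proof.
(* [4^h] is even, as [h > 0], and [3^h] is odd. *)
have odd_q : odd q.
  by rewrite /q /order6; case: ifP => _;
    rewrite ?oddD ?oddB ?leq_exp2r // !oddX (gtn_eqF h_gt0).
rewrite /half -natrD (_ : _ + _ = q.+1)%N; last lia.
by rewrite -natr1 qS add0r.
Qed.

Let w2 : w ^+ 2 = w - 1. Proof. exact: eis_w2. Qed.

Definition eis_root : S := half * (1 + w).

Lemma eis_root2 : eis_root + eis_root = 1 + w.
Proof. by rewrite -mulrDl half2 mul1r. Qed.

(** The square of [(1 + w) / 2] is [3w / 4], and [q = 0] in the ring means
    [(3 / 4)^h = (-1)^l = w^(3l)]. *)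
Lemma eis_root_exp : eis_root ^+ (2 * h) = w ^+ (h + 3 * l).
Proof.
have root2 : eis_root ^+ 2 = half ^+ 2 * (3%:R * w).
  have E (x y : S) : (x * (1 + y)) ^+ 2 = x ^+ 2 * (1 + y + y + y ^+ 2) by ring.
  rewrite E w2; have {}E (y : S) : 1 + y + y + (y - 1) = 3%:R * y by ring.
  by rewrite E.
have w3 : w ^+ 3 = -1.
  by rewrite exprS w2 mulrBr mulr1 -expr2 w2; ring.
have half4 : half ^+ 2 * 4%:R = 1.
  have E (x : S) : x ^+ 2 * 4%:R = (x + x) ^+ 2 by ring.
  by rewrite E half2 expr1n.
have three_exp : 3%:R ^+ h = (-1) ^+ l * 4%:R ^+ h :> S.
  rewrite -signr_odd; move: qS; rewrite /q /order6; case: (odd l).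
    by rewrite natrD !natrX expr1 mulN1r => /eqP;
      rewrite addrC addr_eq0 => /eqP.
  by rewrite natrB ?leq_exp2r // !natrX mul1r => /eqP; rewrite subr_eq0 => /eqP.
have half4_exp : (half ^+ 2) ^+ h * 4%:R ^+ h = 1.
  by rewrite -exprMn half4 expr1n.
rewrite exprM root2 (exprMn _ (half ^+ 2)) (exprMn _ 3%:R) three_exp mulrA.
rewrite mulrCA half4_exp mulr1.
by rewrite exprD exprM w3 mulrC.
Qed.
End EisensteinModel.

(** * Independence of the translations, and the conclusion *)

Lemma J6_translations_free (m h k' l : nat) (k : int) :
  let z := J6y m k ^+ m in
  (0 < h)%N -> m = (2 * h)%N -> k' = (h + 3 * l)%N -> coprime (2 * h) k' ->
  (k = k' %[mod (6 * m)%N])%Z ->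
  forall i j, (J6t m k / z) ^+ i * ((J6t m k / z) ^ z^-1) ^+ j = 1 ->
  (order6 h l %| i)%N /\ (order6 h l %| j)%N.
Proof.
move=> z h_gt0 mE k'E co_hk kk' i j ij1.
(* The case of exponent 1 is set apart, since ['Z_1] has two elements. *)
have [q_le1|q_gt1] := leqP (order6 h l) 1.
  have := order6_gt0 l h_gt0.
  by case: (order6 h l) q_le1 => [|[|]] //; rewrite !dvd1n.
have k'_gt0 : (0 < k')%N by rewrite k'E addn_gt0 h_gt0.
have := affine_model (eis_w2 _) (eis_root2 h_gt0 q_gt1) co_hk h_gt0 k'_gt0.
rewrite {1}k'E => /(_ (eis_root_exp h_gt0 q_gt1)).
move=> [T [Y [T6 Y6 rel e0E e1E]]].
have YE : expgz Y k = Y ^+ k'.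
  by apply: expgz_eqmod kk'; rewrite mulnC expgnA mE.
have [|f [fM ft fy]] := J6_lift (k := k) (m := m) T6 (Y := Y).
  by rewrite expgzB YE mE.
have fz : f z = Y ^+ (2 * h) by rewrite /z (morphX fM) fy mE.
have : f ((J6t m k / z) ^+ i * ((J6t m k / z) ^ z^-1) ^+ j) = 1.
  by rewrite ij1 (morph1 fM).
have fJ : f ((J6t m k / z) ^ z^-1) = (T / Y ^+ (2 * h)) ^ (Y ^+ (2 * h))^-1.
  by rewrite !conjgE !fM !(morphV fM) fz ft.
rewrite fM !(morphX fM) fJ e1E fM (morphV fM) fz ft e0E.
(* The image of 0 is [i(1 - w) - jw = i - (i + j)w]; if it is 0, then [q] divides [i] and
   [i + j]. *)
move/permP/(_ 0%R); rewrite permM !translation_expg perm1 add0r.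
rewrite !eis_mulrn => xE; have i0 := congr1 fst xE; have ij0 := congr1 snd xE.
have dvdq n : (n%:R = 0 :> 'Z_(order6 h l))%R -> (order6 h l %| n)%N.
  move=> /(congr1 val) /=; rewrite val_Zp_nat //= => n0.
  by rewrite /dvdn n0.
rewrite /= subr0 oppr0 mul0rn addr0 in i0.
rewrite /= sub0r !mulNrn -opprD i0 add0r in ij0.
split; apply: dvdq; first exact: i0.
by apply: oppr_inj; rewrite oppr0.
Qed.

Lemma J6_isomorphic (m h k' l : nat) (k : int) :
  (0 < h)%N -> m = (2 * h)%N -> k' = (h + 3 * l)%N -> coprime (2 * h) k' ->
  (k = k' %[mod (6 * m)%N])%Z ->
  isomorphic (derived_subgroup (J6 m k))
    (cyclic_group (order6 h l) * cyclic_group (order6 h l))%type.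
Proof.
move=> h_gt0 mE k'E co_hk kk'.
have free := J6_translations_free h_gt0 mE k'E co_hk kk'.
have rel := J6_rel m k; rewrite expgzB in rel.
have zc : commute (J6y m k ^+ m) (expgz (J6y m k) k) by apply: commute_expgz.
have t6 := J6_t6 m k.
(* Derived while [k] is still an integer: [y^(6m) = 1] is what permits replacing [k] by [k']. *)
have z6 := rotation_expg6 t6 (relator_expg2 t6 rel) (relator_expg3 t6 zc rel).
have cE : expgz (J6y m k) k = J6y m k ^+ k'.
  by apply: expgz_eqmod kk'; rewrite mulnC expgnA z6.
rewrite cE in rel; move: (J6t m k) (J6y m k) (@J6_generated m k) t6 rel free.
move: (J6 m k) => G t y gen t6 rel free; rewrite mE in rel free.
exact: J6_derived_isomorphic gen h_gt0 k'E co_hk t6 rel free.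
Qed.

Theorem theorem6p2 (m : nat) (k : int)
    (m_ge1 : (1 <= m)%N)
    (coprime_mk : gcdz m%:Z k = 1%Z)
    (mod6 : (m%:Z - 2%:Z * k = 0 %[mod 6])%Z) :
  ((m%:Z - 2%:Z * k = 0 %[mod 12])%Z ->
    let q := (4 ^ (m %/ 2) - 3 ^ (m %/ 2))%N in
    isomorphic (derived_subgroup (J6 m%:Z k))
               (cyclic_group q * cyclic_group q)%type) /\
  ((m%:Z - 2%:Z * k = 6 %[mod 12])%Z ->
    let q := (4 ^ (m %/ 2) + 3 ^ (m %/ 2))%N in
    isomorphic (derived_subgroup (J6 m%:Z k))
               (cyclic_group q * cyclic_group q)%type).
Proof.
have [h mE] : exists h, m = (2 * h)%N by exists m./2; lia.
have h_gt0 : (0 < h)%N by lia.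
(* Adding [6 * m] to the residue ensures [h <= k'], so that [l] below can be a natural number. *)
pose k' := (`|(k %% (6 * m)%N)%Z| + 6 * m)%N.
have [r kE] : exists r, k = (r * 6 * m%:Z + k'%:Z)%R.
  exists ((k %/ (6 * m)%N)%Z - 1)%R; have := divz_eq k (6 * m)%N.
  have : (0 <= (k %% (6 * m)%N)%Z)%R by apply: modz_ge0; lia.
  rewrite /k'; lia.
have kk' : (k = k' %[mod (6 * m)%N])%Z.
  by rewrite kE -mulrA -PoszM modzMDl.
have co_hk : coprime (2 * h) k'.
  rewrite /coprime -mE; move: coprime_mk; rewrite kE gcdzMDl.
  by rewrite /gcdz /= => -[->].
pose l := ((k' - h) %/ 3)%N.
have k'E : k' = (h + 3 * l)%N by lia.
have iso := J6_isomorphic h_gt0 mE k'E co_hk kk'.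
have -> : (m %/ 2 = h)%N by lia.
rewrite /order6 in iso.
(* Modulo 12, [m - 2k] is [-6l], so each congruence fixes the parity of [l]. *)
split=> mod12; case: ifP iso => //; lia.
Qed.
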